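(* Let $G$ be a finite abelian group acting by $*$-automorphisms $\gamma_g$ on a unital $C^*$-algebra $B$, let $A=B^G$ be the fixed point algebra, and let $B_k$, $k\in\widehat G$, be the spectral subspaces. The following are equivalent: (1) For any $k\in\widehat G$, $B_k$ contains an element which is unitary in $B$. (2) For any $k\in\widehat G$, $B_k$ contains an element which is invertible in $B$. (3) For any $k\in\widehat G$, $B_k$ is a free, rank-1, right $A$-module. (4) For any $k\in\widehat G$, $B_k$ is a free, rank-1, left $A$-module. (5) For any $k\in\widehat G$, $B_k$ contains an element which is a generator both as a right and as a left $A$-module, and the action is free.
   Context: All $C^*$-algebras are separable, complex and unital. $\widehat G$ is the Pontryagin dual of $G$ (written additively), and $B_k=\{b\in B:\gamma_g(b)=\langle k,g\rangle b\ \ \forall g\in G\}$, an $A$-$A$-bimodule under multiplication in $B$. $B_k$ is a free rank-1 right (left) $A$-module if it is isomorphic to $A$ as a right (left) $A$-module. An element $x$ of a right $A$-module $X$ is a generator if $X=\{xa:a\in A\}$; an element $x$ of a left $A$-module $X$ is a generator if $X=\{ax:a\in A\}$. Free (saturated) action: let $B\rtimes G$ be the crossed product, i.e. the $C^*$-algebra of formal sums $\sum_gb_g\delta_g$ with $\delta_gb=\gamma_g(b)\delta_g$, $\delta_g\delta_h=\delta_{gh}$, $\delta_g^*=\delta_{g^{-1}}$. $B$ is a $B\rtimes G$-$A$ bimodule via $b_g\delta_g\cdot x=b_g\gamma_g(x)$ and right multiplication by $A$, with inner products ${}_{B\rtimes G}\langle b_1,b_2\rangle=\sum_gb_1\gamma_g(b_2^*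 )\delta_g$ and $\langle b_1,b_2\rangle_A=\frac1{|G|}\sum_g\gamma_g(b_1^*b_2)$. The action is free if (the completion of) this bimodule is a Morita equivalence bimodule, i.e. if the left inner product is full: the linear span of the elements ${}_{B\rtimes G}\langle b_1,b_2\rangle$ is dense in $B\rtimes G$. *)

(* Defs.v *)
From HB Require Import structures.
From mathcomp Require Import all_boot all_order all_algebra all_fingroup.
From mathcomp Require Import complex.
From mathcomp Require Import all_classical all_reals all_analysis.

Set Implicit Arguments.
Unset Strict Implicit.
Unset Printing Implicit Defensive.

Import Order.TTheory GRing.Theory Num.Theory.
Import numFieldNormedType.Exports.

Local Open Scope classical_set_scope.
Local Open Scope ring_scope.
Local Open Scope complex_scope.

(* A join of GRing.Algebra with the normed modules of the library is refused by
   Hierarchy Builder, because numDomainType already joins rings and norms; the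
   norm is therefore part of this interface.
   In algType, 1 != 0, so the zero C*-algebra is excluded; then cnorm 1 = 1
   follows from the axioms, and so does the nonnegativity of cnorm. *)
HB.mixin Record Algebra_isCStarAlgebra (R : realType) B
    & GRing.Algebra R[i] B := {
  cnorm : B -> R ;
  star : B -> B ;
  cnorm_eq0 : forall x, cnorm x = 0 -> x = 0 ;
  cnormD : forall x y, cnorm (x + y) <= cnorm x + cnorm y ;
  cnormZ : forall (c : R[i]) x, cnorm (c *: x) = Normc.normc c * cnorm x ;
  cnormM : forall x y, cnorm (x * y) <= cnorm x * cnorm y ;
  cnorm_complete : forall u : nat -> B,
    (forall e : R, 0 < e -> exists N : nat, forall m n : nat,
       (N <= m)%N -> (N <= n)%N -> cnorm (u m - u n) < e) ->
    exists l : B, cnorm (u n - l) @[n --> \oo] --> (0 : R) ;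
  starD : forall x y, star (x + y) = star x + star y ;
  starZ : forall (c : R[i]) x, star (c *: x) = conjc c *: star x ;
  starM : forall x y, star (x * y) = star y * star x ;
  starK : involutive star ;
  cnorm_star : forall x, cnorm (star x * x) = cnorm x ^+ 2
}.

#[short(type="cstarAlgType")]
HB.structure Definition CStarAlgebra (R : realType) :=
  {B of GRing.Algebra R[i] B & Algebra_isCStarAlgebra R B}.

Definition norm_separable (R : realType) (B : cstarAlgType R) :=
  exists2 D : set B, countable D &
    forall (x : B) (e : R), 0 < e -> exists2 y, D y & cnorm (x - y) < e.

Record pontryagin_dual (R : realType) (G : finGroupType) := PontryaginDual {
  dual_fun :> G -> R[i] ;
  dual_id : dual_fun 1%g = 1 ;
  dual_mul : forall g h, dual_fun (g * h)%g = dual_fun g * dual_fun h ;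
  dual_norm : forall g, `|dual_fun g| = 1
}.

Record cstar_action (R : realType) (G : finGroupType) (B : cstarAlgType R) :=
  CStarAction {
  act_fun :> G -> {lrmorphism B -> B} ;
  act_id : forall x, act_fun 1%g x = x ;
  act_mul : forall g h x, act_fun (g * h)%g x = act_fun g (act_fun h x) ;
  act_star : forall g x, act_fun g (star x) = star (act_fun g x)
}.

Section Elements.
Variables (R : realType) (B : cstarAlgType R).

Definition invertible (u : B) := exists v : B, u * v = 1 /\ v * u = 1.

Definition unitary (u : B) := star u * u = 1 /\ u * star u = 1.

End Elements.

(* Modules given as additive subgroups X of B, under multiplication in B by the
   elements of a unital subring A. *)
Section Submodules.
Variables (B : pzRingType) (A X : set B).

Definition right_free_rank1 := exists phi : B -> B,
  [/\ set_bij A X phi,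
      forall a a', A a -> A a' -> phi (a + a') = phi a + phi a' &
      forall x a, A x -> A a -> phi (x * a) = phi x * a].

Definition left_free_rank1 := exists phi : B -> B,
  [/\ set_bij A X phi,
      forall a a', A a -> A a' -> phi (a + a') = phi a + phi a' &
      forall x a, A x -> A a -> phi (a * x) = a * phi x].

Definition right_generator (x : B) := X = [set x * a | a in A].

Definition left_generator (x : B) := X = [set a * x | a in A].

End Submodules.

Section Action.
Variables (R : realType) (G : finGroupType) (B : cstarAlgType R).
Variable gamma : cstar_action G B.

Definition fixed_algebra : set B := [set b | forall g, gamma g b = b].

Definition spectral_subspace (k : pontryagin_dual R G) : set B :=
  [set b | forall g, gamma g b = k g *: b].

(* f : {ffun G -> B} stands for the formal sum \sum_g f g \delta_g in the
   crossed product; the two operations below are forced by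
   \delta_g b = gamma_g(b) \delta_g, \delta_g \delta_h = \delta_(g h),
   \delta_g^* = \delta_(g^-1). *)
Definition cp_mul (f h : {ffun G -> B}) : {ffun G -> B} :=
  [ffun g => \sum_(s : G) f s * gamma s (h (s^-1 * g)%g)].

Definition cp_star (f : {ffun G -> B}) : {ffun G -> B} :=
  [ffun g => gamma g (star (f g^-1%g))].

(* The norm of the right Hilbert B-module l^2(G, B), realised on formal sums
   with the B-valued inner product E(x^* y), where E is the canonical
   conditional expectation f |-> f 1 of the crossed product onto B. *)
Definition cp_l2norm (f : {ffun G -> B}) : R :=
  Num.sqrt (cnorm (cp_mul (cp_star f) f 1%g)).

(* The C*-norm of the crossed product: the operator norm in the regular
   representation, i.e. for left multiplication on l^2(G, B). It is the only
   C*-norm on the formal sums, G being finite. *)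
Definition cp_norm (f : {ffun G -> B}) : \bar R :=
  ereal_sup [set (cp_l2norm (cp_mul f x))%:E | x in
              [set x : {ffun G -> B} | cp_l2norm x <= 1]].

Definition left_inner (b1 b2 : B) : {ffun G -> B} :=
  [ffun g => b1 * gamma g (star b2)].

Definition left_inner_span : set {ffun G -> B} :=
  [set f | exists (n : nat) (c : 'I_n -> R[i]) (b1 b2 : 'I_n -> B),
     f = \sum_(i < n) c i *: left_inner (b1 i) (b2 i)].

Definition free_action :=
  forall f : {ffun G -> B}, forall e : R, 0 < e ->
  exists2 s, left_inner_span s & (cp_norm (f - s)%R < e%:E)%E.

End Action.

(* Main.v *)
Require Import Defs.
From mathcomp Require Import all_boot all_order all_algebra all_fingroup.
From mathcomp Require Import complex.
From mathcomp Require Import all_classical all_reals all_analysis.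
From mathcomp Require Import ring lra all_field all_character.

(* (3) => (2): let x generate the free module B_k and let h = x^* x.  A self-adjoint
   d with d^8 = h^2 is built by iterating the square root.  Since
   |x z| <= |d^2 z| for self-adjoint z commuting with h and d, the elements
   x (d + 1/n)^-1 converge in the closed space B_k to some x c, and x c d = x
   gives c d = 1; so h is invertible and x is left invertible.  Generators of
   B_k and B_{-k} are related by the adjoint, hence they are also right
   invertible.
   (2) => (1) is polar decomposition.
   (2) => freeness: the left inner products of elements of B and u_k^*, with u_k
   invertible in B_k, span the crossed product because the characters span the
   functions on G.
   (5) => (2): an approximation of the unit of the crossed product by left inner
   products, applied to the vector k / |G|, gives b with 1 - b x small in the
   mean over G; as B_{-k} = x^* A, this makes x^* right invertible.
   The functional calculus is replaced throughout by the following remark: a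
   self-adjoint contraction b is the real part of the unitary
   b + i (1 - b^2)^(1/2); in particular |1 - b^2| <= 1, and *-morphisms are
   contractive. *)

Set Implicit Arguments.
Unset Strict Implicit.
Unset Printing Implicit Defensive.

Import Order.TTheory GRing.Theory Num.Theory.
Import numFieldNormedType.Exports.

Local Open Scope classical_set_scope.
Local Open Scope ring_scope.
Local Open Scope complex_scope.

(** * Norm, completeness and fixed points *)

Section Norm.
Variables (R : realType) (B : cstarAlgType R).
Implicit Types (x y z : B) (t : R).

Lemma cnorm0 : cnorm (0 : B) = 0.
Proof. by rewrite -(scale0r (0 : B)) cnormZ Normc.normc0 mul0r. Qed.

Lemma cnormN x : cnorm (- x) = cnorm x.
Proof. by rewrite -scaleN1r cnormZ normcN Normc.normc1 mul1r. Qed.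

Lemma cnorm_ge0 x : 0 <= cnorm x.
Proof.
have := cnormD x (- x); rewrite subrr cnorm0 cnormN -mulr2n.
by rewrite pmulrn_lge0.
Qed.

Lemma cnormB x y : cnorm (x - y) <= cnorm x + cnorm y.
Proof. by apply: (le_trans (cnormD _ _)); rewrite cnormN. Qed.

Lemma cnorm_sym x y : cnorm (x - y) = cnorm (y - x).
Proof. by rewrite -cnormN opprB. Qed.

Lemma cnorm_tri z x y : cnorm (x - y) <= cnorm (x - z) + cnorm (z - y).
Proof. by have := cnormD (x - z) (z - y); rewrite addrA subrK. Qed.

Lemma cnormRZ t x : cnorm (t%:C *: x) = `|t| * cnorm x.
Proof. by rewrite cnormZ /Normc.normc /= expr0n /= addr0 sqrtr_sqr. Qed.

Lemma cnorm_gt0 x : x != 0 -> 0 < cnorm x.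
Proof.
move=> x0; rewrite lt_neqAle cnorm_ge0 andbT eq_sym.
by apply: contra x0 => /eqP/cnorm_eq0 ->.
Qed.

Lemma cnorm_small x : (forall e : R, 0 < e -> cnorm x <= e) -> x = 0.
Proof.
move=> h; apply: cnorm_eq0; apply/eqP; rewrite eq_le cnorm_ge0 andbT.
by apply/ler_addgt0Pr => e e0; rewrite add0r h.
Qed.

Lemma star0 : star (0 : B) = 0.
Proof. by rewrite -[in LHS](scale0r (0 : B)) starZ conjc0 scale0r. Qed.

Lemma starN x : star (- x) = - star x.
Proof. by apply/eqP; rewrite -addr_eq0 -starD addNr star0. Qed.

Lemma starB x y : star (x - y) = star x - star y.
Proof. by rewrite starD starN. Qed.

Lemma starRZ t x : star (t%:C *: x) = t%:C *: star x.
Proof. by rewrite starZ conjc_real. Qed.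

Lemma star1 : star (1 : B) = 1.
Proof. by rewrite -[LHS]mulr1 -{2}(starK (1 : B)) -starM mulr1 starK. Qed.

Lemma starX x n : star (x ^+ n) = star x ^+ n.
Proof. by elim: n => [|n IH]; rewrite ?star1// exprS starM IH -exprSr. Qed.

(** One factor cancels in |y|^2 = |y^* y| <= |y^*| |y|; applying this to the adjoint as well gives
    equality. *)
Lemma cnorm_starE x : cnorm (star x) = cnorm x.
Proof.
suff le y : cnorm y <= cnorm (star y).
  by apply/eqP; rewrite eq_le le andbT -{2}(starK x) le.
have [->|y0] := eqVneq y 0; first by rewrite star0.
by rewrite -(ler_pM2r (cnorm_gt0 y0)) -expr2 -cnorm_star cnormM.
Qed.

Lemma cnorm1 : cnorm (1 : B) = 1.
Proof.
have := cnorm_star (1 : B); rewrite star1 mulr1 expr2 => /eqP.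
rewrite -{1}[cnorm 1]mulr1 => /eqP/mulfI -> //.
by rewrite gt_eqF// cnorm_gt0// oner_neq0.
Qed.

Lemma cnormX x n : cnorm (x ^+ n) <= cnorm x ^+ n.
Proof.
elim: n => [|n IH]; first by rewrite !expr0 cnorm1.
rewrite !exprS; apply: (le_trans (cnormM _ _)).
by rewrite ler_wpM2l// cnorm_ge0.
Qed.

Lemma cnorm_sa x : star x = x -> cnorm x ^+ 2 = cnorm (x ^+ 2).
Proof. by move=> sx; rewrite -cnorm_star sx expr2. Qed.

Lemma cnorm_le1M x y : cnorm x <= 1 -> cnorm y <= 1 -> cnorm (x * y) <= 1.
Proof.
move=> hx hy; apply: (le_trans (cnormM _ _)).
by rewrite mulr_ile1// cnorm_ge0.
Qed.

Lemma cnorm_isometry u : star u * u = 1 -> cnorm (u : B) = 1.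
Proof.
move=> uu; have := cnorm_star u; rewrite uu cnorm1 => /esym/eqP.
by rewrite sqrp_eq1 ?cnorm_ge0// => /eqP.
Qed.

(** A projection satisfies |e| = |e|^2, so its norm is 0 or 1. *)
Lemma projection_norm_lt1 e :
  star e = e -> e * e = e -> cnorm (e : B) < 1 -> e = 0.
Proof.
move=> se ee e1; apply/eqP; apply: contraLR e1 => e0; rewrite -leNgt.
have := cnorm_star e; rewrite se ee expr2 => /eqP.
rewrite -{1}[cnorm e]mulr1 => /eqP/mulfI <- //.
by rewrite gt_eqF// cnorm_gt0.
Qed.

Lemma projection_norm_le1 e : star e = e -> e * e = e -> cnorm (e : B) <= 1.
Proof.
move=> se ee; have := cnorm_star e; rewrite se ee expr2.
have [->|e0] := eqVneq e 0; first by rewrite cnorm0 ler01.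
move/eqP; rewrite -{1}[cnorm e]mulr1 => /eqP/mulfI <- //.
by rewrite gt_eqF// cnorm_gt0.
Qed.

(** Norm-closedness, phrased through [cnorm] because [B] carries no topology here. *)
Definition cadherent (S : set B) : Prop :=
  forall l, (forall e : R, 0 < e -> exists2 y, S y & cnorm (y - l) < e) -> S l.

Lemma cadherentI (S T : set B) :
  cadherent S -> cadherent T -> cadherent (S `&` T).
Proof.
move=> hS hT l hl; split; [apply: hS|apply: hT] => e e0;
  by have [y [] ? ? ?] := hl e e0; exists y.
Qed.

Lemma cadherent_forall (I : Type) (S : I -> set B) :
  (forall i, cadherent (S i)) -> cadherent [set x | forall i, S i x].
Proof.
move=> hS l hl i; apply: hS => e e0.
by have [y hy ?] := hl e e0; exists y.
Qed.

Lemma cadherent_eq (f g : B -> B) (K : R) :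
  (forall x y, cnorm (f x - f y) <= K * cnorm (x - y)) ->
  (forall x y, cnorm (g x - g y) <= K * cnorm (x - y)) ->
  cadherent [set x | f x = g x].
Proof.
move=> hf hg l hl /=; apply/eqP; rewrite -subr_eq0; apply/eqP.
apply: cnorm_small => e e0.
have K0 : 0 < `|K| + 1 by rewrite ltr_wpDl.
have [|y /= fgy yl] := hl (e / (2 * (`|K| + 1))).
  by rewrite divr_gt0// mulr_gt0.
have kl : K * cnorm (y - l) <= e / 2.
  have : (`|K| + 1) * cnorm (y - l) <= e / 2.
    apply: (@le_trans _ _ ((`|K| + 1) * (e / (2 * (`|K| + 1))))).
      by rewrite ler_pM2l// ltW.
    by rewrite le_eqVlt; apply/orP; left; apply/eqP; field; rewrite gt_eqF.
  apply: le_trans; rewrite ler_wpM2r ?cnorm_ge0//.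
  by apply: (le_trans (ler_norm K)); rewrite lerDl.
apply: (le_trans (cnorm_tri (f y) _ _)).
have h1 := hf l y; have h2 := hg y l; move: h1 h2; rewrite -fgy (cnorm_sym l).
lra.
Qed.

Lemma cadherent_star : cadherent [set x : B | star x = x].
Proof.
apply: (@cadherent_eq _ id 1) => x y; rewrite mul1r//.
by rewrite -starB cnorm_starE.
Qed.

Lemma cadherent_commute y : cadherent [set x | x * y = y * x].
Proof.
apply: (@cadherent_eq ( *%R^~ y) _ (cnorm y)) => a b.
  by rewrite -mulrBl mulrC cnormM.
by rewrite -mulrBr cnormM.
Qed.

(** Convergence of [v] makes [u] Cauchy; completeness of [B] enters only here. *)
Lemma dominated_cauchy (u : nat -> B) (v : nat -> R) :
  cvgn v -> (forall m n, cnorm (u m - u n) <= `|v m - v n|) ->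
  exists l, forall e, 0 < e ->
    exists N, forall n, (N <= n)%N -> cnorm (u n - l) < e.
Proof.
move=> /cvgrPdist_lt cv uv.
have [e e0|l /cvgrPdist_lt hl] := cnorm_complete u _.
  have [|N _ hN] := cv (e / 2); first by rewrite divr_gt0.
  exists N => m n hm hn; apply: (le_lt_trans (uv m n)).
  have h1 := hN m hm; have h2 := hN n hn; rewrite /= in h1 h2.
  rewrite -[v m](subrK (limn v)) -addrA.
  apply: (le_lt_trans (ler_normD _ _)); rewrite distrC.
  move: h1 h2; lra.
exists l => e e0; have [N _ hN] := hl e e0; exists N => n /hN /=.
by rewrite sub0r normrN ger0_norm// cnorm_ge0.
Qed.

(* The iterates of [F] from 0 are dominated by those of the scalar map [Phi]. *)
Lemma majorant_fixpoint (S : set B) (F : B -> B) (Phi : R -> R) (M K : R) :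
  cadherent S -> S 0 -> (forall y, S y -> S (F y)) ->
  0 <= M -> cnorm (F 0) <= Phi 0 ->
  (forall Y, 0 <= Y -> Y <= M -> Phi Y <= M) ->
  (forall y z Y Z, cnorm y <= Y -> cnorm z <= Z -> Y <= M ->
     cnorm (y - z) <= Y - Z -> cnorm (F y - F z) <= Phi Y - Phi Z) ->
  (forall y z, cnorm y <= M -> cnorm z <= M ->
     cnorm (F y - F z) <= K * cnorm (y - z)) ->
  exists l, [/\ S l, cnorm l <= M & F l = l].
Proof.
move=> hS S0 SF M0 F0 PM Phi_major FK.
pose u n := iter n F 0; pose v n := iter n Phi 0.
(* Joint induction: [v] stays below [M] and bounds [u], and its increments bound those of [u]. *)
have uv n : cnorm (u n) <= v n <= M /\ cnorm (u n.+1 - u n) <= v n.+1 - v n.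
  elim: n => [|n [/andP[h1 h2] h3]]; first by rewrite /= cnorm0 lexx M0 !subr0.
  have h4 : cnorm (u n.+1) <= v n.+1.
    rewrite -[u n.+1](subrK (u n)); apply: (le_trans (cnormD _ _)); lra.
  have h5 : v n.+1 <= M.
    by apply: PM => //; apply: le_trans h1; exact: cnorm_ge0.
  by rewrite h4 h5; split => //; apply: Phi_major.
have duv m n : (n <= m)%N -> cnorm (u m - u n) <= v m - v n.
  move=> /subnK <-; elim: (m - n)%N => [|p IH].
    by rewrite add0n !subrr cnorm0.
  apply: (le_trans (cnorm_tri (u (p + n)%N) _ _)).
  have [_] := uv (p + n)%N; rewrite addSn; lra.
have vmono : {homo v : n m / (n <= m)%N >-> n <= m}.
  move=> n m /duv h; rewrite -subr_ge0; apply: le_trans h; exact: cnorm_ge0.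
have cv : cvgn v.
  apply: nondecreasing_is_cvgn => //; exists M => _ [n _ <-].
  by case: (uv n) => /andP[].
have [m n|l hl] := dominated_cauchy cv (u := u).
  case/orP: (leq_total n m) => [nm|mn].
    by apply: (le_trans (duv _ _ nm)); exact: ler_norm.
  by rewrite cnorm_sym distrC; apply: (le_trans (duv _ _ mn)); exact: ler_norm.
have Su n : S (u n) by elim: n => //= n; exact: SF.
have lM : cnorm l <= M.
  apply/ler_addgt0Pr => e /hl[N /(_ N (leqnn N))]; rewrite cnorm_sym => hN.
  have := cnormD (l - u N) (u N); rewrite subrK.
  case: (uv N) => /andP[h1 h2] _; lra.
exists l; split => //.
  by apply: hS => e /hl[N hN]; exists (u N) => //; exact: hN.
apply/eqP; rewrite -subr_eq0; apply/eqP; apply: cnorm_small => e e0.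
(* Of the |K| + 2 shares of [e], |K| go to the Lipschitz term and one to the distance from [u N.+1]
   to [l]; one is spare. *)
have K0 : 0 < `|K| + 2 by rewrite ltr_wpDl.
have [|N hN] := hl (e / (`|K| + 2)); first by rewrite divr_gt0.
apply: (le_trans (cnorm_tri (u N.+1) _ _)).
have h1 := hN N (leqnn N); have h2 := hN N.+1 (leqnSn N).
have uNM : cnorm (u N) <= M by case: (uv N) => /andP[a b] _; exact: le_trans b.
have := FK _ _ lM uNM; rewrite (cnorm_sym l) => h3.
have h4 : K * cnorm (u N - l) <= `|K| * (e / (`|K| + 2)).
  apply: (@le_trans _ _ (`|K| * cnorm (u N - l))).
    by rewrite ler_wpM2r ?cnorm_ge0// ler_norm.
  by rewrite ler_wpM2l// ltW.
have : `|K| * (e / (`|K| + 2)) + e / (`|K| + 2) + e / (`|K| + 2) = e.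
  by field; rewrite gt_eqF.
have : 0 < e / (`|K| + 2) by rewrite divr_gt0.
rewrite /= in h3 *; move: h2; rewrite /=; lra.
Qed.

(** Fixed point of z -> (1 + y z) / t, with majorant Z -> (1 + |y| Z) / t, whose fixed point is the
    stated bound. Iterating among elements that commute with [y] makes the inverse two-sided. *)
Lemma neumann y t : cnorm y < t ->
  exists r, [/\ (t%:C *: 1 - y) * r = 1, r * (t%:C *: 1 - y) = 1 &
             cnorm r <= (t - cnorm y)^-1].
Proof.
move=> yt; have y0 := cnorm_ge0 y; have t0 : 0 < t by lra.
have nt s : 0 <= s -> `|t^-1| * s = s / t.
  by move=> s0; rewrite gtr0_norm ?invr_gt0// mulrC.
have [||||||||r [hr nr fr]] := @majorant_fixpoint
    [set z | z * y = y * z] (fun z => (t^-1)%:C *: (1 + y * z))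
    (fun Z => (1 + cnorm y * Z) / t) (t - cnorm y)^-1 (cnorm y / t).
- exact: cadherent_commute.
- by rewrite /= mul0r mulr0.
- move=> z /= hz; rewrite -scalerAl -scalerAr mulrDl mulrDr mul1r mulr1.
  by rewrite -mulrA hz.
- by rewrite invr_ge0; lra.
- by rewrite !mulr0 !addr0 cnormRZ cnorm1 nt.
- move=> Y Y0 YM; rewrite ler_pdivrMr//.
  apply: (@le_trans _ _ (1 + cnorm y * (t - cnorm y)^-1)).
    by rewrite lerD2l ler_wpM2l.
  by rewrite le_eqVlt; apply/orP; left; apply/eqP; field; lra.
- move=> a b Y Z _ _ _ abYZ.
  rewrite -scalerBr cnormRZ opprD addrACA subrr add0r -mulrBr nt ?cnorm_ge0//.
  rewrite -mulrBl ler_wpM2r ?invr_ge0 ?(ltW t0)// opprD addrACA subrr add0r.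
  by rewrite -mulrBr; apply: (le_trans (cnormM _ _)); rewrite ler_wpM2l.
- move=> a b _ _.
  rewrite -scalerBr cnormRZ opprD addrACA subrr add0r -mulrBr nt ?cnorm_ge0//.
  by rewrite mulrAC ler_wpM2r ?invr_ge0 ?(ltW t0)// cnormM.
have tr : t%:C *: r = 1 + y * r.
  rewrite -{1}fr scalerA -rmorphM/= mulfV ?gt_eqF// scale1r.
  by [].
exists r; split => //.
  by rewrite mulrBl -scalerAl mul1r tr addrK.
by rewrite mulrBr -scalerAr mulr1 tr hr addrK.
Qed.

(** The equation (1 - y)^2 = 1 - p reads y = (p + y^2) / 2. On the unit ball this map is only
    1-Lipschitz, so the majorant Y -> (1 + Y^2) / 2, with fixed point 1, replaces a contraction
    argument. The set [S] records properties that the root inherits. *)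
Lemma sqrt_one_sub (S : set B) p :
  cadherent S -> S 0 -> (forall y, S y -> S (2^-1%:C *: (p + y ^+ 2))) ->
  cnorm p <= 1 ->
  exists y, [/\ S y, cnorm y <= 1 & (1 - y) ^+ 2 = 1 - p].
Proof.
move=> hS S0 SF p1.
have n2 : `|2^-1 : R| = 2^-1 by rewrite ger0_norm// invr_ge0.
have sq y z : cnorm (y ^+ 2 - z ^+ 2) <=
    (cnorm y + cnorm z) * cnorm (y - z).
  have -> : y ^+ 2 - z ^+ 2 = y * (y - z) + (y - z) * z.
    by rewrite mulrBr mulrBl addrA subrK !expr2.
  apply: (le_trans (cnormD _ _)); rewrite [leRHS]mulrDl.
  by apply: lerD; last rewrite [leRHS]mulrC; exact: cnormM.
have [||||y [Sy ny fy]] := @majorant_fixpoint S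
    (fun y => 2^-1%:C *: (p + y ^+ 2)) (fun Y => 2^-1 * (1 + Y ^+ 2)) 1 1
    hS S0 SF ler01.
- by rewrite !expr0n !addr0 cnormRZ n2 ler_pM2l ?invr_gt0.
- move=> Y Y0 Y1; have := @lerXn2r _ 2 Y 1.
  by rewrite !nnegrE => /(_ Y0 ler01 Y1); lra.
- move=> a b Y Z aY bZ Y1 abYZ.
  rewrite -scalerBr cnormRZ n2 opprD addrACA subrr add0r -mulrBr.
  rewrite ler_pM2l ?invr_gt0//; apply: (le_trans (sq _ _)).
  have -> : 1 + Y ^+ 2 - (1 + Z ^+ 2) = (Y + Z) * (Y - Z) by ring.
  by apply: ler_pM; rewrite ?addr_ge0 ?cnorm_ge0//; apply: lerD.
- move=> a b a1 b1; rewrite -scalerBr cnormRZ n2 opprD addrACA subrr add0r.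
  rewrite mul1r; apply: (@le_trans _ _ (2^-1 * (2 * cnorm (a - b)))).
    rewrite ler_pM2l ?invr_gt0//; apply: (le_trans (sq _ _)).
    rewrite ler_wpM2r ?cnorm_ge0//; lra.
  by rewrite mulrA mulVf ?mul1r.
exists y; split => //.
have : p + y ^+ 2 = y *+ 2.
  rewrite -{2}fy -scaler_nat scalerA -[2%:R](rmorph_nat (real_complex R)).
  by rewrite -rmorphM/= mulfV ?scale1r.
rewrite -[1 - y]opprB sqrrN sqrrB1 => <-.
by rewrite opprD addrCA subrr addr0 addrC.
Qed.

End Norm.

(** * Self-adjoint elements *)

Section SelfAdjoint.
Variables (R : realType) (B : cstarAlgType R).
Implicit Types (b c e h x y z p : B) (t : R).

Lemma scaleRi_sq c : 'i%C *: ('i%C *: c) = - c.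
Proof. by rewrite scalerA -expr2 sqr_i scaleN1r. Qed.

Lemma star_scalei c : star ('i%C *: c) = - ('i%C *: star c).
Proof.
rewrite starZ -scaleNr; congr (_ *: _).
by apply/eqP; rewrite eq_complex /= oppr0 !eqxx.
Qed.

(* [b + i c] is unitary, and [b] is its real part. *)
Lemma cnorm_cosine b c : star b = b -> star c = c -> b * c = c * b ->
  b ^+ 2 + c ^+ 2 = 1 -> cnorm b <= 1.
Proof.
move=> sb sc bc b2c2; pose u := b + 'i%C *: c.
have su : star u = b - 'i%C *: c by rewrite starD star_scalei sb sc.
have uu : star u * u = 1.
  rewrite su mulrDl !mulrDr !mulNr -!scalerAr -!scalerAl scaleRi_sq opprK bc.
  by rewrite addrA addrK -!expr2.
have nu := cnorm_isometry uu.
have : cnorm (star u + u) <= 2.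
  by apply: (le_trans (cnormD _ _)); rewrite cnorm_starE nu.
have -> : star u + u = 2%:C *: b.
  by rewrite su addrCA subrK -mulr2n -scaler_nat rmorph_nat.
by rewrite cnormRZ gtr0_norm// -{2}[2]mulr1 ler_pM2l.
Qed.

(** The element c is the square root of 1 - b^2, found among the self-adjoint elements commuting
    with [b]. *)
Lemma cosine_sine b : star b = b -> cnorm b <= 1 ->
  exists c, [/\ star c = c, b * c = c * b & b ^+ 2 + c ^+ 2 = 1].
Proof.
move=> sb b1.
have [||||y [[sy yb] _ ysq]] := @sqrt_one_sub _ _
    ([set y | star y = y] `&` [set y | y * b = b * y]) (b ^+ 2).
- by apply: cadherentI; [exact: cadherent_star|exact: cadherent_commute].
- by split; rewrite /= ?star0 ?mul0r ?mulr0.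
- move=> y [/= sy yb]; split => /=; first by rewrite starRZ starD !starX sy sb.
  rewrite -scalerAl -scalerAr mulrDl mulrDr -exprSr -exprS.
  congr (_ *: (_ + _)).
  by rewrite expr2 -mulrA yb mulrA yb mulrA.
- by rewrite (le_trans (cnormX _ _))// expr_le1// cnorm_ge0.
exists (1 - y); split.
- by rewrite starB star1 sy.
- by rewrite mulrBl mulrBr mul1r mulr1; rewrite /= in yb; rewrite yb.
- by rewrite ysq addrC subrK.
Qed.

(** Here 1 - b^2 = c^2, and [c] is a cosine as well, with [b] as its sine. *)
Lemma cnorm_one_sub_sq b : star b = b -> cnorm b <= 1 ->
  cnorm (1 - b ^+ 2) <= 1.
Proof.
move=> sb /(cosine_sine sb)[c [sc bc bc1]].
have nc : cnorm c <= 1 by apply: (@cnorm_cosine c b) => //; rewrite addrC.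
rewrite -bc1 addrC addKr; apply: (le_trans (cnormX _ _)).
by rewrite expr_le1// cnorm_ge0.
Qed.

(** A morphism preserves the relation b^2 + c^2 = 1, so it maps cosines to cosines. The C*-identity
    reduces a general [x] to the self-adjoint element x^* x. *)
Lemma star_morphism_contractive (f : {lrmorphism B -> B}) :
  (forall x, f (star x) = star (f x)) -> forall x, cnorm (f x) <= cnorm x.
Proof.
move=> fs.
have sa1 b : star b = b -> cnorm b <= 1 -> cnorm (f b) <= 1.
  move=> sb /(cosine_sine sb)[c [sc bc bc1]].
  apply: (@cnorm_cosine _ (f c)); rewrite -?fs ?sb ?sc//.
    by rewrite -!rmorphM bc.
  by rewrite -!rmorphXn -rmorphD bc1 rmorph1.
have sa b : star b = b -> cnorm (f b) <= cnorm b.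
  move=> sb; have [->|b0] := eqVneq b 0; first by rewrite raddf0.
  have nb := cnorm_gt0 b0.
  have := sa1 ((cnorm b)^-1%:C *: b).
  rewrite starRZ sb linearZ/= !cnormRZ ger0_norm ?invr_ge0 ?(ltW nb)//.
  rewrite mulVf ?gt_eqF// => /(_ erefl (lexx _)).
  by rewrite mulrC ler_pdivrMr// mul1r.
move=> x; rewrite -(@ler_pXn2r _ 2) ?nnegrE ?cnorm_ge0//.
by rewrite -!cnorm_star -fs -rmorphM sa// starM starK.
Qed.

(* A substitute for the positivity of [star z * z].  Here [f = - z z^*] is also
   a projection and [e + f = - (a^2 + b^2) / 2] with [a], [b] self-adjoint;
   hence [1 + s (e + f)] is a contraction for small [s > 0], which compressed
   by [e] forces [e = 0]. *)
Lemma star_mul_not_negative z e :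
  star e = e -> e * e = e -> star z * z = - e -> e = 0.
Proof.
move=> se ee zz.
(* By the C*-identity, since (1 - e) z^* z (1 - e) = - (1 - e) e (1 - e) = 0. *)
have ze : z * e = z.
  apply/eqP; rewrite eq_sym -subr_eq0; apply/eqP/cnorm_eq0/eqP.
  have -> : z - z * e = z * (1 - e) by rewrite mulrBr mulr1.
  rewrite -sqrf_eq0 -cnorm_star starM mulrA.
  rewrite -[_ * star z * z]mulrA zz mulrN mulNr starB star1 se.
  by rewrite mulrBl mul1r ee subrr mul0r oppr0 cnorm0.
pose f := - (z * star z).
have sf : star f = f by rewrite starN starM starK.
have ff : f * f = f.
  by rewrite mulrNN -mulrA [_ * (z * _)]mulrA zz mulrA mulrN ze mulNr.
have zz' : z * star z = - f by rewrite opprK.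
clearbody f; pose a := z + star z; pose b := 'i%C *: (star z - z).
have sa : star a = a by rewrite starD starK addrC.
have sb : star b = b by rewrite star_scalei starB starK -scalerN opprB.
have ab : a ^+ 2 + b ^+ 2 = - ((e + f) *+ 2).
  rewrite !expr2 /a /b -scalerAl -scalerAr scaleRi_sq.
  rewrite mulrBl mulrDl !mulrBr !mulrDr !opprB addrACA.
  have cancel (p q : B) : p + q + (q - p) = q *+ 2.
    by rewrite [p + q]addrC addrACA subrr addr0 mulr2n.
  have cancel' (p q : B) : p + q + (p - q) = p *+ 2.
    by rewrite addrACA subrr addr0 mulr2n.
  rewrite cancel cancel' zz zz' !mulNrn -opprD -mulrnDl.
  by rewrite addrC.
clearbody a b; have [t t0 [ta tb]] : exists2 t : R, 0 < t &
    cnorm (t%:C *: a) <= 1 /\ cnorm (t%:C *: b) <= 1.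
  have m0 : 0 < 1 + cnorm a + cnorm b by rewrite !ltr_wpDr ?cnorm_ge0.
  exists (1 + cnorm a + cnorm b)^-1; first by rewrite invr_gt0.
  rewrite !cnormRZ gtr0_norm ?invr_gt0// ![_^-1 * _]mulrC !ler_pdivrMr// !mul1r.
  by have := cnorm_ge0 a; have := cnorm_ge0 b; split; lra.
(* Twice this element is the sum of the contractions 1 - (t a)^2 and 1 - (t b)^2. *)
have nef : cnorm (1 + (t ^+ 2)%:C *: (e + f)) <= 1.
  rewrite -(@ler_pM2l _ 2)// mulr1 -[X in X * _](@ger0_norm _ 2)// -cnormRZ.
  have -> : 2%:C *: (1 + (t ^+ 2)%:C *: (e + f)) =
      (1 - (t%:C *: a) ^+ 2) + (1 - (t%:C *: b) ^+ 2).
    rewrite addrACA -opprD !exprZn -scalerDr ab scalerN opprK.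
    by rewrite scalerDr !rmorphXn/= rmorph_nat !scaler_nat -mulr2n scalerMnr.
  apply: (le_trans (cnormD _ _)).
  have := @cnorm_one_sub_sq (t%:C *: a); have := @cnorm_one_sub_sq (t%:C *: b).
  by rewrite !starRZ sa sb => /(_ erefl tb) ? /(_ erefl ta); lra.
have e1 := projection_norm_le1 se ee.
apply: projection_norm_lt1 => //; set s := t ^+ 2 in nef.
have s0 : 0 < s by rewrite exprn_gt0.
(* Adding s e (1 - f) e to the compression by [e] cancels the term s e f e; hence |e| <= (1 + s) /
   (1 + 2 s) < 1. *)
have : cnorm ((1 + 2 * s)%:C *: e) <= 1 + s.
  have -> : (1 + 2 * s)%:C *: e =
      e * (1 + s%:C *: (e + f)) * e + s%:C *: (e * (1 - f) * e).
    have -> : e * (1 + s%:C *: (e + f)) * e = e + s%:C *: (e + e * f * e).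
      by rewrite mulrDr mulr1 mulrDl -scalerAr -scalerAl mulrDr mulrDl !ee.
    rewrite mulrBr mulr1 mulrBl ee -addrA -scalerDr addrACA subrr addr0.
    rewrite [2 * s]mulrC rmorphD rmorphM/= rmorph_nat scalerDl scale1r.
    by rewrite -scalerA scaler_nat mulr2n.
  apply: (le_trans (cnormD _ _)); apply: lerD.
    by rewrite !cnorm_le1M.
  rewrite cnormRZ gtr0_norm// -[leRHS]mulr1 ler_pM2l// !cnorm_le1M//.
  apply: projection_norm_le1; first by rewrite starB star1 sf.
  by rewrite mulrBl mul1r mulrBr mulr1 ff subrr subr0.
rewrite cnormRZ gtr0_norm; last by lra.
move=> h; rewrite -(@ltr_pM2l _ (1 + 2 * s)); last by lra.
by apply: (le_lt_trans h); lra.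
Qed.
End SelfAdjoint.

(** * Generators of the spectral subspaces *)

Section Generators.
Variables (R : realType) (G : finGroupType) (B : cstarAlgType R).
Variable gamma : cstar_action G B.
Implicit Types (a d h r x y z : B) (k : pontryagin_dual R G).

Lemma act_contractive g x : cnorm (gamma g x) <= cnorm x.
Proof. by apply: star_morphism_contractive => y; rewrite act_star. Qed.

(** The action is contractive, so the equations defining B_k are continuous. *)
Lemma cadherent_spectral k : cadherent (spectral_subspace gamma k).
Proof.
apply: cadherent_forall => g.
have n0 : 0 <= Normc.normc (k g) by case: (k g) => u v; rewrite sqrtr_ge0.
apply: (@cadherent_eq _ _ _ _ (1 + Normc.normc (k g))) => x y.
  rewrite -raddfB (le_trans (act_contractive _ _))// ler_peMl ?cnorm_ge0//.
  by rewrite lerDl.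
by rewrite -scalerBr cnormZ ler_wpM2r ?cnorm_ge0// lerDr.
Qed.

Lemma cadherent_fixed : cadherent (fixed_algebra gamma).
Proof.
apply: cadherent_forall => g.
apply: (@cadherent_eq _ _ _ _ 1) => x y; rewrite mul1r//.
by rewrite -raddfB act_contractive.
Qed.

Lemma spectral_fixed_mul k x a : spectral_subspace gamma k x ->
  fixed_algebra gamma a -> spectral_subspace gamma k (x * a).
Proof. by move=> hx ha g; rewrite rmorphM/= hx ha scalerAl. Qed.

Lemma fixed_spectral_mul k x a : spectral_subspace gamma k x ->
  fixed_algebra gamma a -> spectral_subspace gamma k (a * x).
Proof. by move=> hx ha g; rewrite rmorphM/= hx ha scalerAr. Qed.

(** A closed set, stable under the iterations used, that keeps roots and inverses in A and commuting
    with [h]. *)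
Definition selfadjoint_fixed h : set B :=
  [set y | star y = y] `&` [set y | y * h = h * y] `&` fixed_algebra gamma.

Lemma inverse_commute a r y : a * r = 1 -> r * a = 1 -> a * y = y * a ->
  r * y = y * r.
Proof.
move=> ar ra ay.
by rewrite -[LHS]mulr1 -ar mulrA -[r * y * a]mulrA -ay mulrA ra mul1r.
Qed.

Lemma selfadjoint_fixed_inverse h a r : a * r = 1 -> r * a = 1 ->
  selfadjoint_fixed h a -> selfadjoint_fixed h r.
Proof.
move=> ar ra [[/= sa ah] fa]; split; [split => /=|].
- by rewrite -[LHS]mulr1 -ar mulrA -sa -starM ar star1 mul1r.
- exact: inverse_commute ah.
- move=> g; rewrite -[LHS]mulr1 -ar mulrA -[X in _ * X * _](fa g) -rmorphM/= ra.
  by rewrite rmorph1 mul1r.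
Qed.

(** The bound on 1 - s is the hypothesis on [p] again, so that roots can be iterated. *)
Lemma selfadjoint_fixed_sqrt h p :
  selfadjoint_fixed h p -> cnorm (1 - p) <= 1 ->
  exists s, [/\ selfadjoint_fixed h s, cnorm (1 - s) <= 1 & s ^+ 2 = p].
Proof.
move=> [[/= sp ph] fp] np.
have [||||y [[[/= sy yh] fy] ny ysq]] :=
  @sqrt_one_sub _ _ (selfadjoint_fixed h) (1 - p).
- apply: cadherentI; last exact: cadherent_fixed.
  by apply: cadherentI; [exact: cadherent_star|exact: cadherent_commute].
- split; last by move=> g; rewrite rmorph0.
  by split; rewrite /= ?star0 ?mul0r ?mulr0.
- move=> y [[/= sy yh] fy]; split; [split => /=|].
  + by rewrite starRZ starD starB starX star1 sp sy.
  + rewrite -scalerAl -scalerAr; congr (_ *: _).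
    rewrite mulrDl mulrDr mulrBl mulrBr mul1r mulr1 ph; congr (_ + _).
    by rewrite expr2 -mulrA yh mulrA yh mulrA.
  + move=> g; rewrite linearZ /= rmorphD rmorphB rmorph1 rmorphXn/= fp fy.
    by [].
- by [].
exists (1 - y); split; last by rewrite ysq opprB addrC subrK.
- split; [split => /=|].
  + by rewrite starB star1 sy.
  + by rewrite mulrBl mulrBr mul1r mulr1 yh.
  + by move=> g; rewrite rmorphB rmorph1/= fy.
- by rewrite opprB addrC subrK.
Qed.

(* [d] plays the role of [|h|^(1/4)]. *)
Lemma selfadjoint_fixed_root8 h : star h = h -> fixed_algebra gamma h ->
  cnorm h <= 1 ->
  exists d, [/\ selfadjoint_fixed h d, cnorm (1 - d) <= 1 & d ^+ 8 = h ^+ 2].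
Proof.
move=> sh fh nh.
(* Starting from h^2 avoids the positivity of [h]: |1 - h^2| <= 1 holds for every self-adjoint
   contraction. *)
have [||s [hs ns s2]] := @selfadjoint_fixed_sqrt h (h ^+ 2).
- split; [split => /=|].
  + by rewrite starX sh.
  + by rewrite -exprSr -exprS.
  + by move=> g; rewrite rmorphXn/= fh.
- exact: cnorm_one_sub_sq.
have [t [ht nt t2]] := selfadjoint_fixed_sqrt hs ns.
have [d [hd nd d2]] := selfadjoint_fixed_sqrt ht nt.
by exists d; split => //; rewrite -[8%N]/(2 * (2 * 2))%N !exprM d2 t2 s2.
Qed.

(** Two C*-identities give |x z|^4 = |h z^2|^2 = |h^2 z^4| = |d^8 z^4| = |(d^2 z)^4|. *)
Lemma cnorm_mul_le_root d h x z : star x * x = h ->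
  d ^+ 8 = h ^+ 2 -> star z = z -> z * h = h * z -> z * d = d * z ->
  cnorm (x * z) <= cnorm (d ^+ 2 * z).
Proof.
move=> xx dh sz zh zd.
have sh : star h = h by rewrite -xx starM starK.
rewrite -(@ler_pXn2r _ 4) ?nnegrE ?cnorm_ge0//.
have -> : cnorm (x * z) ^+ 4 = cnorm ((d ^+ 2 * z) ^+ 4).
  have zc : GRing.comm h (z * z) by apply: commrM; apply: commr_sym.
  have -> : cnorm (x * z) ^+ 4 = cnorm (star (x * z) * (x * z)) ^+ 2.
    by rewrite cnorm_star -exprM.
  have -> : star (x * z) * (x * z) = h * (z * z).
    by rewrite starM sz -mulrA (mulrA (star x)) xx mulrA zh mulrA.
  rewrite cnorm_sa; last by rewrite !starM sh sz zc.
  rewrite exprMn_comm// -dh [in RHS]exprMn_comm; last first.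
    by apply: commr_sym; apply: commrX.
  by rewrite -exprM -expr2 -exprM.
exact: cnormX.
Qed.

(* With [d = |h|^(1/4)], the sequence [x (d + 1/n)^-1] of [B_k] is Cauchy and
   its limit [x c] satisfies [x c d = x], so that [c d = 1] by injectivity. *)
Lemma generator_left_invertible_contraction k x :
  spectral_subspace gamma k x -> cnorm x <= 1 ->
  fixed_algebra gamma (star x * x) ->
  (forall y, spectral_subspace gamma k y ->
     exists2 a, fixed_algebra gamma a & y = x * a) ->
  (forall a, fixed_algebra gamma a -> x * a = 0 -> a = 0) ->
  exists l, l * x = 1.
Proof.
move=> kx nx fh gen inj; set h := star x * x in fh.
have xx : star x * x = h by [].
have sh : star h = h by rewrite starM starK.
have nh : cnorm h <= 1 by rewrite cnorm_star expr_le1 ?cnorm_ge0.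
clearbody h.
have [d [[[/= sd dh] fd] nd d8]] := selfadjoint_fixed_root8 sh fh nh.
pose e n : R := harmonic n; have e0 n : 0 < e n by exact: harmonic_gt0.
pose D n : B := (e n)%:C%:A + d.
have DE n : D n = (1 + e n)%:C%:A - (1 - d).
  by rewrite rmorphD/= scalerDl scale1r opprB [1 + _]addrC addrACA subrr addr0.
have Dd n : D n * d = d * D n by rewrite mulrDl mulrDr mulr_algl mulr_algr.
(* By [neumann], as |1 - d| <= 1 < 1 + e n. *)
have /boolp.choice[r hr] n :
    exists s, [/\ D n * s = 1, s * D n = 1 & cnorm s <= (e n)^-1].
  have ne : cnorm (1 - d) < 1 + e n by have := e0 n; lra.
  have [s [s1 s2 s3]] := neumann ne; exists s; rewrite DE; split => //.
  apply: (le_trans s3); rewrite lef_pV2 ?posrE//; lra.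
have rS n : selfadjoint_fixed h (r n).
  have [r1 r2 _] := hr n; apply: selfadjoint_fixed_inverse r1 r2 _.
  split; [split => /=|].
  - by rewrite starD starRZ star1 sd.
  - by rewrite mulrDl mulrDr mulr_algl mulr_algr dh.
  - by move=> g; rewrite rmorphD/= linearZ/= rmorph1 fd.
have rd n : r n * d = d * r n.
  by have [r1 r2 _] := hr n; exact: inverse_commute (Dd n).
have rr m n : r n * r m = r m * r n.
  have [r1 r2 _] := hr n; apply: inverse_commute r1 r2 _.
  by rewrite mulrDl mulrDr mulr_algl mulr_algr rd.
have dr n : d * r n = 1 - (e n)%:C *: r n.
  have [<- _ _] := hr n.
  by rewrite mulrDl mulr_algl addrAC subrr add0r.
have dr2 n : cnorm (d * r n) <= 2.
  rewrite dr; apply: (le_trans (cnormB _ _)).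
  rewrite cnorm1 cnormRZ gtr0_norm//; have [_ _ rn] := hr n.
  have : e n * cnorm (r n) <= 1.
    by rewrite mulrC -ler_pdivlMr// mul1r.
  lra.
(* The norm is at most that of d^2 r_m r_n = (d r_m) (d r_n), a product of two factors of norm at
   most 2. *)
have xrr m n : cnorm (x * (r m * r n)) <= 4.
  have [[/= sm mh] fm] := rS m; have [[/= sn nh'] fn] := rS n.
  apply: (@le_trans _ _ (cnorm (d ^+ 2 * (r m * r n)))).
    apply: cnorm_mul_le_root xx d8 _ _ _.
    + by rewrite starM sm sn rr.
    + by rewrite -mulrA nh' mulrA mh mulrA.
    + by rewrite -mulrA rd mulrA rd mulrA.
  rewrite expr2 -mulrA (mulrA d (r m)) -rd mulrA (mulrA d) -!mulrA mulrA.
  apply: (le_trans (cnormM _ _)).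
  have -> : (4 : R) = 2 * 2 by ring.
  by rewrite ler_pM ?cnorm_ge0.
(* The resolvent identity r_m - r_n = (e_n - e_m) r_m r_n. *)
have dw m n : cnorm (x * r m - x * r n) <= `|4 * e m - 4 * e n|.
  have -> : x * r m - x * r n = (e n - e m)%:C *: (x * (r m * r n)).
    rewrite -mulrBr scalerAr; congr (_ * _).
    have [m1 m2 _] := hr m; have [n1 n2 _] := hr n.
    transitivity (r m * (D n - D m) * r n).
      by rewrite mulrBr mulrBl m2 mul1r -mulrA n1 mulr1.
    rewrite /D opprD addrACA subrr addr0 -scalerBl -rmorphB/=.
    by rewrite mulr_algr scalerAl.
  rewrite cnormRZ -mulrBr normrM distrC (@ger0_norm _ 4)// mulrC.
  by rewrite ler_wpM2r.
have ce : cvgn (fun n => 4 * e n).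
  by apply: is_cvgMr; apply/cvg_ex; exists 0; exact: cvg_harmonic.
have [w hw] := dominated_cauchy ce dw.
have kw : spectral_subspace gamma k w.
  apply: cadherent_spectral => eps /hw[N /(_ N (leqnn N)) hN].
  by exists (x * r N) => //; apply: spectral_fixed_mul => //; case: (rS N).
have [c fc wc] := gen _ kw.
(* In the limit of x r_n d = x - e_n x r_n the last term vanishes, since x r_n is bounded by 2
   |d|. *)
have wd : w * d = x.
  apply/eqP; rewrite -subr_eq0; apply/eqP/cnorm_small => eps eps0.
  have xrN n : cnorm (x * r n) <= cnorm d * 2.
    have [[/= sn nh'] fn] := rS n.
    apply: (le_trans (cnorm_mul_le_root xx d8 sn nh' (rd n))).
    rewrite expr2 -mulrA; apply: (le_trans (cnormM _ _)).
    by rewrite ler_wpM2l ?cnorm_ge0.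
  have M0 : 0 < cnorm d * 2 + 1 by rewrite ltr_wpDl ?mulr_ge0 ?cnorm_ge0.
  pose eps' := eps / 2 / (cnorm d * 2 + 1).
  have eps'0 : 0 < eps' by rewrite !divr_gt0.
  have eps'E : eps' * (cnorm d * 2 + 1) = eps / 2 by rewrite divfK ?gt_eqF.
  have [N1 hN1] := hw _ eps'0.
  have [N2 _ hN2] := proj1 (cvgrPdist_lt _ _) (@cvg_harmonic R) _ eps'0.
  pose N := maxn N1 N2.
  have h1 := hN1 N (leq_maxl _ _); have := hN2 N (leq_maxr _ _).
  rewrite /= sub0r normrN gtr0_norm ?e0// => h2.
  have -> : w * d - x = - ((x * r N - w) * d + (e N)%:C *: (x * r N)).
    rewrite mulrBl -mulrA rd dr mulrBr mulr1 scalerAr.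
    by rewrite addrAC subrK opprB.
  rewrite cnormN; apply: (le_trans (cnormD _ _)); rewrite cnormRZ gtr0_norm//.
  have h3 : cnorm ((x * r N - w) * d) <= eps' * (cnorm d * 2 + 1).
    apply: (le_trans (cnormM _ _)); rewrite ler_pM ?cnorm_ge0 ?(ltW h1)//.
    by have := cnorm_ge0 d; lra.
  have h4 : e N * cnorm (x * r N) <= eps' * (cnorm d * 2 + 1).
    rewrite ler_pM ?cnorm_ge0 ?(ltW h2) ?(ltW (e0 N))//.
    by have := xrN N; lra.
  by move: h3 h4; rewrite eps'E; lra.
have cd : c * d = 1.
  apply/eqP; rewrite -subr_eq0; apply/eqP/inj.
    by move=> g; rewrite rmorphB rmorphM rmorph1/= fc fd.
  by rewrite mulrBr mulr1 mulrA -wc wd subrr.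
have dc : d * c = 1.
  have dsc : d * star c = 1 by rewrite -{1}sd -starM cd star1.
  have cc : c = star c by rewrite -[LHS]mulr1 -dsc mulrA cd mul1r.
  by rewrite cc.
have c8 : c ^+ 8 * d ^+ 8 = 1.
  by rewrite -exprMn_comm ?cd ?expr1n// /GRing.comm cd dc.
(* Indeed c^8 h x^* x = c^8 h^2 = c^8 d^8 = 1. *)
by exists (c ^+ 8 * h * star x); rewrite -mulrA xx -mulrA -expr2 -d8 c8.
Qed.
End Generators.

(** * Inverses in the dual group *)

Section Dual.
Variables (R : realType) (G : finGroupType).
Implicit Types k l : pontryagin_dual R G.

Lemma dual_conj_id k : conjc (k 1%g) = 1.
Proof. by rewrite dual_id conjc1. Qed.

Lemma dual_conj_mul k g h : conjc (k (g * h)%g) = conjc (k g) * conjc (k h).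
Proof. by rewrite dual_mul rmorphM. Qed.

Lemma dual_conj_norm k g : `|conjc (k g)| = 1.
Proof. by rewrite norm_conjC dual_norm. Qed.

(** The character -k in additive notation. *)
Definition dual_conj k : pontryagin_dual R G :=
  PontryaginDual (dual_conj_id k) (dual_conj_mul k) (dual_conj_norm k).

Lemma dual_conjK k g : conjc (k g) * k g = 1.
Proof. by have := normCKC (k g); rewrite dual_norm expr1n => <-. Qed.

Lemma dual_inv k g : k (g^-1)%g = conjc (k g).
Proof.
by rewrite -[LHS]mul1r -(dual_conjK k g) -mulrA -dual_mul mulgV dual_id mulr1.
Qed.

End Dual.

(** * Bases, adjoints and invertible elements of the spectral subspaces *)

Section Spectral.
Variables (R : realType) (G : finGroupType) (B : cstarAlgType R).
Variable gamma : cstar_action G B.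
Implicit Types (a d h x y z : B) (k : pontryagin_dual R G).
Local Notation A := (fixed_algebra gamma).
Local Notation Bk := (spectral_subspace gamma).

Lemma star_spectral k x : Bk k x -> Bk (dual_conj k) (star x).
Proof. by move=> kx g; rewrite act_star kx starZ. Qed.

Lemma spectral_star k x : Bk (dual_conj k) x -> Bk k (star x).
Proof. by move=> kx g; rewrite act_star kx starZ conjcK. Qed.

Lemma star_fixed a : A a -> A (star a).
Proof. by move=> fa g; rewrite act_star fa. Qed.

Lemma spectral_star_mul_fixed k x y : Bk k x -> Bk k y -> A (star x * y).
Proof.
move=> kx ky g; rewrite rmorphM/= act_star kx ky starZ.
by rewrite -scalerAl -scalerAr scalerA dual_conjK scale1r.
Qed.

Lemma spectral_inverse k u v : Bk k u -> u * v = 1 -> v * u = 1 ->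
  Bk (dual_conj k) v.
Proof.
move=> ku uv vu g.
have -> : gamma g v = dual_conj k g *: (gamma g v * gamma g u * v).
  rewrite ku -scalerAr -scalerAl scalerA dual_conjK scale1r.
  by rewrite -mulrA uv mulr1.
by rewrite -rmorphM/= vu rmorph1 mul1r.
Qed.

Lemma left_right_invertible x l r : l * x = 1 -> x * r = 1 -> invertible x.
Proof.
move=> lx xr; exists r; split => //.
by rewrite -[r]mul1r -lx -[l * x * r]mulrA xr mulr1 lx.
Qed.

Lemma spectral_scale k (c : R[i]) x : Bk k x -> Bk k (c *: x).
Proof. by move=> kx g; rewrite linearZ/= kx !scalerA mulrC. Qed.

(** The element [x] is the image of 1 under an isomorphism of A onto B_k. *)
Definition right_basis k x := [/\ Bk k x,
  forall y, Bk k y -> exists2 a, A a & y = x * a &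
  forall a, A a -> x * a = 0 -> a = 0].

(** Rescaling to norm 1 is possible: if x = 0, injectivity would give 1 = 0. *)
Lemma right_basis_left_invertible k x : right_basis k x -> exists l, l * x = 1.
Proof.
move=> [kx gen inj].
have x0 : x != 0.
  apply/eqP => x0; have := inj 1; rewrite x0 mul0r => h.
  have /eqP := h (fun g => rmorph1 _) erefl.
  by rewrite oner_eq0.
have nx := cnorm_gt0 x0.
pose x' := (cnorm x)^-1%:C *: x.
have xE : x = (cnorm x)%:C *: x'.
  by rewrite scalerA -rmorphM/= mulfV ?gt_eqF// scale1r.
have kx' : Bk k x' by exact: spectral_scale.
have [||||l lx] := @generator_left_invertible_contraction _ _ _ gamma k x' kx'.
- by rewrite cnormRZ gtr0_norm ?invr_gt0// mulVf ?gt_eqF.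
- exact: (spectral_star_mul_fixed kx').
- move=> y /gen[a fa ->]; exists ((cnorm x)%:C *: a).
    by move=> g; rewrite linearZ/= fa.
  by rewrite -scalerAr scalerAl -xE.
- move=> a fa; rewrite -scalerAl => /eqP.
  by rewrite scaler_eq0 fmorph_eq0 invr_eq0 gt_eqF// => /eqP; exact: inj.
exists ((cnorm x)^-1%:C *: l).
by rewrite -scalerAl scalerAr.
Qed.

(** For bases y of B_k and x of B_{-k}, x^* lies in B_k and equals y a; as x is left invertible, x^*
    and hence y are right invertible. *)
Lemma right_basis_invertible : (forall k, exists x, right_basis k x) ->
  forall k, exists2 u, Bk k u & invertible u.
Proof.
move=> basis k; have [y hy] := basis k.
have [x hx] := basis (dual_conj k).
have [l ly] := right_basis_left_invertible hy.
have [l' lx] := right_basis_left_invertible hx.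
have [ky gen _] := hy; have [kx _ _] := hx; exists y => //.
have [a fa xya] := gen _ (spectral_star kx).
apply: (left_right_invertible (r := a * star l') ly).
by rewrite mulrA -xya -starM lx star1.
Qed.

Lemma right_free_rank1_basis k : right_free_rank1 A (Bk k) ->
  exists x, right_basis k x.
Proof.
move=> [phi [[phiS phi_inj phi_surj] phiD phiM]].
have A1 : A 1 by move=> g; rewrite rmorph1.
have A0 : A 0 by move=> g; rewrite rmorph0.
have phiE a : A a -> phi a = phi 1 * a by move=> fa; rewrite -phiM// mul1r.
exists (phi 1); split; first exact: phiS.
- by move=> y /phi_surj[a fa <-]; exists a => //; exact: phiE.
- move=> a fa /=; rewrite -phiE// => pa; apply: phi_inj; rewrite ?inE//.
  by rewrite pa (phiE 0)// mulr0.
Qed.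

(** The adjoint exchanges B_k with B_{-k} and right with left multiplication. *)
Lemma right_left_free_rank1 k :
  right_free_rank1 A (Bk (dual_conj k)) -> left_free_rank1 A (Bk k).
Proof.
move=> [phi [[phiS phi_inj phi_surj] phiD phiM]].
exists (fun x => star (phi (star x))); split.
- split.
  + by move=> a fa; apply: spectral_star; apply: phiS; exact: star_fixed.
  + move=> a b; rewrite !inE => fa fb /(can_inj (@starK _ _)) h.
    by apply/(can_inj (@starK _ _))/phi_inj; rewrite ?inE//; exact: star_fixed.
  + move=> y /star_spectral/phi_surj[a fa ay]; exists (star a).
      exact: star_fixed.
    by rewrite starK ay starK.
- by move=> a b fa fb; rewrite starD phiD ?starD//; exact: star_fixed.
- by move=> x a fx fa; rewrite starM phiM ?starM ?starK//; exact: star_fixed.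
Qed.

Lemma left_right_free_rank1 k :
  left_free_rank1 A (Bk (dual_conj k)) -> right_free_rank1 A (Bk k).
Proof.
move=> [phi [[phiS phi_inj phi_surj] phiD phiM]].
exists (fun x => star (phi (star x))); split.
- split.
  + by move=> a fa; apply: spectral_star; apply: phiS; exact: star_fixed.
  + move=> a b; rewrite !inE => fa fb /(can_inj (@starK _ _)) h.
    by apply/(can_inj (@starK _ _))/phi_inj; rewrite ?inE//; exact: star_fixed.
  + move=> y /star_spectral/phi_surj[a fa ay]; exists (star a).
      exact: star_fixed.
    by rewrite starK ay starK.
- by move=> a b fa fb; rewrite starD phiD ?starD//; exact: star_fixed.
- by move=> x a fx fa; rewrite starM phiM ?starM ?starK//; exact: star_fixed.
Qed.

(** The inverse of [u] lies in B_{-k}, so its adjoint lies in B_k, and products y^* x of elements of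
    B_k are fixed. *)
Lemma spectral_quotient_fixed k u v x : Bk k u -> u * v = 1 -> v * u = 1 ->
  Bk k x -> A (v * x).
Proof.
move=> ku uv vu kx; rewrite -[v]starK.
apply: spectral_star_mul_fixed kx.
by apply: spectral_star; exact: spectral_inverse uv vu.
Qed.

Lemma spectral_quotient_fixed' k u v x : Bk k u -> u * v = 1 -> v * u = 1 ->
  Bk k x -> A (x * v).
Proof.
move=> ku uv vu kx; rewrite -[_ * _]starK starM; apply: star_fixed.
apply: (@spectral_quotient_fixed (dual_conj k) (star u)).
- exact: star_spectral.
- by rewrite -starM vu star1.
- by rewrite -starM uv star1.
- exact: star_spectral.
Qed.

Lemma invertible_right_free_rank1 k u : Bk k u -> invertible u ->
  right_free_rank1 A (Bk k).
Proof.
move=> ku [v [uv vu]]; exists ( *%R u); split.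
- split.
  + by move=> a fa; exact: spectral_fixed_mul.
  + by move=> a b _ _ h; rewrite -[a]mul1r -vu -mulrA h mulrA vu mul1r.
  + move=> y ky; exists (v * y); first exact: spectral_quotient_fixed ky.
    by rewrite mulrA uv mul1r.
- by move=> a b _ _; rewrite mulrDr.
- by move=> x a _ _; rewrite mulrA.
Qed.

Lemma invertible_generators k u : Bk k u -> invertible u ->
  right_generator A (Bk k) u /\ left_generator A (Bk k) u.
Proof.
move=> ku [v [uv vu]]; split; apply/seteqP; split.
- move=> y ky; exists (v * y); first exact: spectral_quotient_fixed ky.
  by rewrite mulrA uv mul1r.
- by move=> _ [a fa <-]; exact: spectral_fixed_mul.
- move=> y ky; exists (y * v); first exact: spectral_quotient_fixed' ky.
  by rewrite -mulrA vu mulr1.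
- by move=> _ [a fa <-]; exact: fixed_spectral_mul.
Qed.

(* [w = u d^-2], where [d^2 = |u^* u|^(1/2)]: then [w^* w] is the sign [s] of
   [u^* u], which is 1 by [star_mul_not_negative]. *)
Lemma invertible_unitary_contraction k u : Bk k u -> cnorm u <= 1 ->
  invertible u -> exists2 w, Bk k w & unitary w.
Proof.
move=> ku nu [v [uv vu]]; pose h := star u * u.
have uuh : star u * u = h by [].
have sh : star h = h by rewrite starM starK.
have fh : A h by exact: (spectral_star_mul_fixed ku).
have nh : cnorm h <= 1 by rewrite cnorm_star expr_le1 ?cnorm_ge0.
have hi : h * (v * star v) = 1.
  by rewrite mulrA -[h * v]mulrA uv mulr1 -starM vu star1.
have ih : (v * star v) * h = 1.
  by rewrite -mulrA [star v * h]mulrA -starM uv star1 mul1r vu.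
set j := v * star v in hi ih.
clearbody h j.
have [d [hd _ d8]] := selfadjoint_fixed_root8 sh fh nh.
(* Inverses of [d] on both sides come from the inverse [j] of [h] through d^8 = h^2. *)
have [D [dD Dd]] : invertible d.
  apply: (@left_right_invertible _ (j ^+ 2 * d ^+ 7) (d ^+ 7 * j ^+ 2)).
    by rewrite -mulrA -exprSr d8 -exprMn_comm ?ih ?expr1n// /GRing.comm hi ih.
  by rewrite mulrA -exprS d8 -exprMn_comm ?hi ?expr1n// /GRing.comm hi ih.
have [[/= sD Dh] fD] := selfadjoint_fixed_inverse dD Dd hd.
have D8 : h ^+ 2 * D ^+ 8 = 1.
  by rewrite -d8 -exprMn_comm ?dD ?expr1n// /GRing.comm dD Dd.
have fDn n : A (D ^+ n) by move=> g; rewrite rmorphXn/= fD.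
have hD n : D ^+ n * h = h * D ^+ n by apply/commr_sym/commrX/commr_sym.
pose s := h * D ^+ 4.
have ss : s * s = 1.
  by rewrite -expr2 exprMn_comm -?exprM// /GRing.comm hD.
have sS : star s = s by rewrite starM sh starX sD hD.
pose w := u * D ^+ 2.
have ww : star w * w = s.
  rewrite starM starX sD -mulrA [star u * _]mulrA uuh mulrA hD -mulrA.
  by rewrite -exprD.
have kw : Bk k w by exact: spectral_fixed_mul.
(* The spectral projection of [s] at -1; since s e = - e, the element z = w e satisfies z^* z = -
   e. *)
pose e := 2^-1%:C *: (1 - s).
have se : star e = e by rewrite starRZ starB star1 sS.
have half : 2%:C *: e = 1 - s.
  by rewrite scalerA -rmorphM/= mulfV// scale1r.
have see : s * e = - e.
  by rewrite -scalerAr mulrBr mulr1 ss -scalerN opprB.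
have ee : e * e = e.
  have e2 : e + e = 2%:C *: e by rewrite -mulr2n -scaler_nat rmorph_nat.
  rewrite {1}/e -scalerAl mulrBl mul1r see opprK e2 scalerA -rmorphM/=.
  by rewrite mulVf// scale1r.
have e0 : e = 0.
  apply: (@star_mul_not_negative _ _ (w * e)) => //.
  by rewrite starM se -mulrA [star w * _]mulrA ww see mulrN ee.
have s1 : s = 1.
  by apply/esym/eqP; rewrite -subr_eq0 -half e0 scaler0.
exists w => //; rewrite s1 in ww; split => //.
(* An isometry with a right inverse is unitary. *)
have wr : w * (d ^+ 2 * v) = 1.
  rewrite mulrA -[w * _]mulrA -exprMn_comm ?Dd ?expr1n ?mulr1//.
  by rewrite /GRing.comm dD Dd.
have -> : star w = d ^+ 2 * v.
  by rewrite -[LHS]mulr1 -wr mulrA ww mul1r.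
by [].
Qed.

Lemma invertible_unitary k u : Bk k u -> invertible u ->
  exists2 w, Bk k w & unitary w.
Proof.
move=> ku [v [uv vu]].
have u0 : u != 0.
  by apply/eqP => u0; have /eqP := uv; rewrite u0 mul0r eq_sym oner_eq0.
have nu := cnorm_gt0 u0.
apply: (@invertible_unitary_contraction k ((cnorm u)^-1%:C *: u)).
- exact: spectral_scale.
- by rewrite cnormRZ gtr0_norm ?invr_gt0// mulVf ?gt_eqF.
- exists ((cnorm u)%:C *: v); rewrite -!scalerAl -!scalerAr !scalerA.
  by rewrite uv vu -!rmorphM/= mulVf ?mulfV ?gt_eqF// scale1r.
Qed.

End Spectral.

(** * Characters of a finite abelian group *)

Section Characters.
Variables (R : realType) (G : finGroupType).

(** The polynomial X^n - 1 splits and is separable, so it has n distinct roots, which suffices for a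
    primitive one. *)
Lemma primitive_root_exists (F : closedFieldType) n : (n%:R != 0 :> F) ->
  exists z : F, n.-primitive_root z.
Proof.
move=> n0; have n_gt0 : (0 < n)%N by case: n n0; rewrite ?eqxx.
have [rs] := closed_field_poly_normal ('X^n - 1 : {poly F}).
rewrite (monicP (monicXnsubC 1 n_gt0)) scale1r => Xn1.
suff /hasP[z _ zn] : has n.-primitive_root rs by exists z.
apply: cyclic.has_prim_root => //.
- by apply/allP => z; rewrite -root_prod_XsubC -Xn1.
- by rewrite -separable.separable_prod_XsubC -Xn1 cyclotomic.separable_Xn_sub_1.
- by rewrite -ltnS -(size_prod_XsubC rs id) -Xn1 size_XnsubC.
Qed.

(** The kernels of the irreducible characters meet trivially, and these characters are linear as the
    group is abelian. Their values are algebraic numbers w^j; replacing the primitive root [w] by a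
    primitive root [z] of R[i] transports them, since w^i = w^j exactly when z^i = z^j. *)
Lemma dual_separates g : abelian [set: G]%SET -> g != 1%g ->
  exists k : pontryagin_dual R G, k g != 1.
Proof.
move=> abG g1; pose n := #|G|.
have n_gt0 : (0 < n)%N by rewrite /n (cardD1 1%g) inE.
have [i chi_g] : exists i : Iirr [set: G]%G, 'chi_i g != 'chi_i 1%g.
  apply/existsP; rewrite -negb_forall; apply: contra g1 => /forallP all1.
  apply/eqP/set1gP; rewrite -(TI_cfker_irr [set: G]%G); apply/bigcapP => i _.
  by rewrite cfkerEirr inE.
have lin : 'chi_i \is a linear_char by apply: (char_abelianP _ abG).
rewrite lin_char1// in chi_g.
have [w prim_w] := C_prim_root_exists n_gt0.
have [z prim_z] : exists z : R[i], n.-primitive_root z.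
  by apply: primitive_root_exists; rewrite pnatr_eq0 -lt0n.
have chi_root h : 'chi_i h ^+ n = 1.
  rewrite -lin_charX ?inE//; have -> : n = #|[set: G]%SET| by rewrite cardsT.
  by rewrite cyclic.expg_cardG ?inE// lin_char1.
pose j h : 'I_n := sval (prim_rootP prim_w (chi_root h)).
have jE h : 'chi_i h = w ^+ j h by exact: svalP (prim_rootP _ _).
pose f h := z ^+ j h.
have f1 h : (f h == 1) = ('chi_i h == 1).
  rewrite jE -(expr0 z) -(expr0 w).
  by rewrite (eq_prim_root_expr prim_z) (eq_prim_root_expr prim_w).
have fM h h' : f (h * h')%g = f h * f h'.
  apply/eqP; rewrite -exprD (eq_prim_root_expr prim_z).
  by rewrite -(eq_prim_root_expr prim_w) exprD -!jE lin_charM ?inE.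
have fid : f 1%g = 1 by apply/eqP; rewrite f1 lin_char1.
have fn h : `|f h| = 1.
  apply/eqP; rewrite -(@pexpr_eq1 _ _ n)// -normrX -exprM mulnC exprM.
  by rewrite (prim_expr_order prim_z) expr1n normr1.
by exists (PontryaginDual fid fM fn); rewrite /= f1.
Qed.

Lemma dual_mul_id (k l : pontryagin_dual R G) : k 1%g * l 1%g = 1.
Proof. by rewrite !dual_id mulr1. Qed.

Lemma dual_mul_mul (k l : pontryagin_dual R G) g h :
  k (g * h)%g * l (g * h)%g = k g * l g * (k h * l h).
Proof. by rewrite !dual_mul mulrACA. Qed.

Lemma dual_mul_norm (k l : pontryagin_dual R G) g : `|k g * l g| = 1.
Proof. by rewrite normrM !dual_norm mulr1. Qed.

Definition dual_prod k l : pontryagin_dual R G :=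
  PontryaginDual (dual_mul_id k l) (dual_mul_mul k l) (dual_mul_norm k l).

Lemma dual_one_mul (g h : G) : (1 : R[i]) = 1 * 1.
Proof. by rewrite mulr1. Qed.

Definition dual_one : pontryagin_dual R G :=
  @PontryaginDual R G (fun _ => 1) erefl dual_one_mul (fun _ => normr1 _).

(** A list of coefficients and characters encodes a linear combination without enumerating the dual
    group. *)
Definition trig_poly (s : seq (R[i] * pontryagin_dual R G)) (g : G) : R[i] :=
  \sum_(p <- s) p.1 * p.2 g.

Lemma trig_polyM s t : exists r, forall g,
  trig_poly r g = trig_poly s g * trig_poly t g.
Proof.
exists [seq (p.1 * q.1, dual_prod p.2 q.2) | p <- s, q <- t] => g.
rewrite /trig_poly big_distrlr/= big_allpairs_dep/=.
by apply: eq_bigr => p _; apply: eq_bigr => q _; rewrite mulrACA.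
Qed.

(* A product of one two-term factor per element of [L]. *)
Lemma trig_poly_vanishing (abG : abelian [set: G]%SET) (L : seq G) :
  1%g \notin L ->
  exists s, trig_poly s 1%g = 1 /\ forall g, g \in L -> trig_poly s g = 0.
Proof.
elim: L => [|h L IH].
  move=> _; exists [:: (1, dual_one)]; split => //.
  by rewrite /trig_poly big_seq1 mulr1.
rewrite inE negb_or eq_sym => /andP[h1 /IH[s [s1 sL]]].
have [k kh] := dual_separates abG h1.
have kh0 : 1 - k h != 0 by rewrite subr_eq0 eq_sym.
pose c := (1 - k h)^-1.
(* The new factor (k g - k h) / (1 - k h) is 1 at the identity and 0 at [h]. *)
have [r hr] := trig_polyM s [:: (c, k); (- (k h * c), dual_one)].
have tE g : trig_poly [:: (c, k); (- (k h * c), dual_one)] g = (k g - k h) * c.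
  by rewrite /trig_poly big_cons big_seq1/= mulr1 mulrBl [c * _]mulrC.
exists r; split; first by rewrite hr s1 tE dual_id mul1r mulfV.
move=> g; rewrite inE hr tE => /orP[/eqP->|/sL->]; last by rewrite mul0r.
by rewrite subrr mul0r mulr0.
Qed.

Lemma trig_poly_delta : abelian [set: G]%SET ->
  exists s, forall g, trig_poly s g = (g == 1%g)%:R.
Proof.
move=> abG.
have [|s [s1 sL]] := @trig_poly_vanishing abG (enum (predC1 (1%g : G))).
  by rewrite mem_enum !inE eqxx.
exists s => g; have [->//|g1] := eqVneq g 1%g.
by rewrite sL// mem_enum !inE.
Qed.

End Characters.

(** * Freeness *)

Section Freeness.
Variables (R : realType) (G : finGroupType) (B : cstarAlgType R).
Variable gamma : cstar_action G B.
Implicit Types (a b x y z T : B) (k : pontryagin_dual R G) (c : R).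
Local Notation A := (fixed_algebra gamma).
Local Notation Bk := (spectral_subspace gamma).

Lemma cp_l2norm0 : cp_l2norm gamma 0 = 0.
Proof.
rewrite /cp_l2norm ffunE big1 ?cnorm0 ?sqrtr0// => s _.
by rewrite !ffunE raddf0 mulr0.
Qed.

Lemma cp_norm0 : (cp_norm gamma 0%R <= 0)%E.
Proof.
apply: ge_ereal_sup => _ [x _ <-].
rewrite (_ : cp_mul gamma 0 x = 0) ?cp_l2norm0//.
by apply/ffunP => g; rewrite !ffunE big1// => s _; rewrite ffunE mul0r.
Qed.

(** If v u = 1 with u in B_k, the left inner product of F v and u^* is h -> k(h) F. Taking F = sum_g
    k(g^-1) f(g) and combining the characters into the delta function recovers [f] exactly, so [f]
    is its own approximant. *)
Lemma invertible_free : abelian [set: G]%SET ->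
  (forall k, exists2 u, Bk k u & invertible u) -> free_action gamma.
Proof.
move=> abG inv f e e0; exists f; last first.
  by rewrite subrr; apply: le_lt_trans cp_norm0 _; rewrite lte_fin.
have /boolp.choice[u hu] : forall k, exists u, Bk k u /\ invertible u.
  by move=> k; have [u ? ?] := inv k; exists u.
have /boolp.choice[v hv] k : exists v, v * u k = 1.
  by have [_ [v [_ vu]]] := hu k; exists v.
have [s hs] := trig_poly_delta R abG.
pose t := in_tuple s.
pose F i := \sum_(g : G) (tnth t i).2 g^-1%g *: f g.
exists (size s), (fun i => (tnth t i).1), (fun i => F i * v (tnth t i).2),
  (fun i => star (u (tnth t i).2)).
apply/ffunP => h; rewrite sum_ffunE.
transitivity (\sum_i ((tnth t i).1 * (tnth t i).2 h) *: F i); last first.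
  apply: eq_bigr => i _; rewrite !ffunE starK.
  have [ku _] := hu (tnth t i).2.
  by rewrite ku -scalerAr -mulrA hv mulr1 scalerA.
transitivity (\sum_(g : G) trig_poly s (h * g^-1)%g *: f g).
  rewrite (bigD1 h)//= hs mulgV eqxx scale1r big1 ?addr0// => g gh.
  by rewrite hs -eq_mulgV1 eq_sym (negbTE gh) scale0r.
under eq_bigr do rewrite /trig_poly big_tnth scaler_suml.
rewrite exchange_big; apply: eq_bigr => i _ /=.
rewrite scaler_sumr; apply: eq_bigr => g _.
by rewrite dual_mul scalerA mulrA.
Qed.

(** Reindexing by s -> g s. Up to the factor |G| this is the projection of [z] onto B_k. *)
Lemma spectral_average k z :
  Bk k (\sum_(s : G) conjc (k s) *: gamma s z).
Proof.
move=> g; rewrite raddf_sum scaler_sumr.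
rewrite [RHS](reindex_inj (mulgI g))/=; apply: eq_bigr => s _.
rewrite linearZ/= -act_mul scalerA dual_mul rmorphM mulrA.
by rewrite (mulrC (k g)) dual_conjK mul1r.
Qed.

(** The vector c k of l^2(G, B); it tests a formal sum on its Fourier coefficient at k. *)
Definition scaled_dual c k : {ffun G -> B} :=
  [ffun t => (c%:C * k t)%:A].

(** The phases k(g) have modulus 1 and cancel in the inner product. *)
Lemma cp_l2norm_scaled_dual c k T :
  cp_l2norm gamma [ffun g => (c%:C * k g) *: T] =
  Num.sqrt (c ^+ 2 * cnorm (\sum_g gamma g (star T * T))).
Proof.
have -> : c ^+ 2 = `|c ^+ 2| by rewrite ger0_norm// sqr_ge0.
rewrite -cnormRZ /cp_l2norm ffunE; congr (Num.sqrt (cnorm _)).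
rewrite scaler_sumr; apply: eq_bigr => s _.
rewrite !ffunE mulg1 -rmorphM starZ -scalerAl -scalerAr scalerA/= linearZ/=.
have -> : conjc (c%:C * k s^-1%g) = c%:C * conjc (k s^-1%g).
  by rewrite rmorphM; congr (_ * _); exact: conjc_real.
by rewrite mulrACA dual_conjK mulr1 -rmorphM/= -expr2.
Qed.

Lemma cp_mul_scaled_dual c k (F : {ffun G -> B}) :
  cp_mul gamma F (scaled_dual c k) =
  [ffun g => (c%:C * k g) *: \sum_s conjc (k s) *: F s].
Proof.
apply/ffunP => g; rewrite !ffunE scaler_sumr; apply: eq_bigr => s _.
rewrite ffunE linearZ/= rmorph1 mulr_algr scalerA dual_mul dual_inv.
by rewrite -mulrA [k g * _]mulrC.
Qed.

(* Applying an approximation of [delta_1] in the crossed product to the vector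
   [k / |G|] gives [T = 1 - b x] with [sum_g gamma_g(T^* T)] small.  Expanding
   this sum exhibits [|G|] as nearly a right multiple of [x^*]. *)
Lemma free_left_generator_left_invertible k x : free_action gamma -> Bk k x ->
  left_generator A (Bk k) x -> exists l, l * x = 1.
Proof.
move=> free kx gen.
have G0 : 0 < #|G|%:R :> R by rewrite ltr0n (cardD1 1%g) inE.
pose c : R := #|G|%:R^-1; have c0 : 0 < c by rewrite invr_gt0.
have c0' := ltW c0.
have c1 : c <= 1 by rewrite invf_le1// ler1n (cardD1 1%g) inE.
pose delta : {ffun G -> B} := [ffun g => (g == 1%g)%:R].
have [s [n [co [b1 [b2 sE]]]] hs] := free delta c c0.
pose T := \sum_g conjc (k g) *: (delta - s) g.
(* For c = 1 / |G| the test vector has norm sqrt c <= 1, so its image has norm below the tolerance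
   [c]; that norm is c times the square root of the quantity to be bounded. *)
have TN : cnorm (\sum_g gamma g (star T * T)) < 1.
  have : ((cp_l2norm gamma (cp_mul gamma (delta - s) (scaled_dual c k)))%:E
          < c%:E)%E.
    apply: le_lt_trans hs; apply: ereal_sup_ubound.
    exists (scaled_dual c k) => //=.
    rewrite (_ : scaled_dual c k = [ffun g => (c%:C * k g) *: 1])//.
    rewrite cp_l2norm_scaled_dual star1 mulr1.
    under eq_bigr do rewrite rmorph1.
    rewrite sumr_const -scaler_nat -(rmorph_nat (real_complex R)) cnormRZ.
    rewrite cnorm1 mulr1 normr_nat expr2 -mulrA mulVf ?gt_eqF// mulr1.
    by rewrite -sqrtr1 ler_sqrt.
  rewrite lte_fin cp_mul_scaled_dual cp_l2norm_scaled_dual -/T.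
  rewrite -(@ltr_pXn2r _ 2)// ?nnegrE ?sqrtr_ge0 ?(ltW c0)//.
  rewrite sqr_sqrtr ?mulr_ge0 ?sqr_ge0 ?cnorm_ge0// -[ltRHS]mulr1.
  by rewrite ltr_pM2l// exprn_gt0.
(* Each term of [s] contributes a multiple of [b1 i] times an average in B_k = A x. *)
have [b Tb] : exists b, T = 1 - b * x.
  pose y i := \sum_g conjc (k g) *: gamma g (star (b2 i)).
  have /boolp.choice[a ha] i : exists a, a * x = y i.
    have : Bk k (y i) by exact: spectral_average.
    by rewrite gen => -[a _ ax]; exists a.
  exists (\sum_i co i *: (b1 i * a i)).
  rewrite /T; under eq_bigr do rewrite !ffunE scalerBr.
  rewrite sumrB; congr (_ - _).
    rewrite (bigD1 1%g)//= eqxx dual_id conjc1 scale1r big1 ?addr0// => g.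
    by move=> /negbTE->; rewrite scaler0.
  rewrite mulr_suml sE.
  under eq_bigr do rewrite sum_ffunE scaler_sumr.
  rewrite exchange_big; apply: eq_bigr => i _ /=.
  rewrite -scalerAl -mulrA ha mulr_sumr scaler_sumr; apply: eq_bigr => g _.
  by rewrite !ffunE -scalerAr !scalerA mulrC.
(* Chosen so that gamma_g(b x) = beta_g x. *)
pose beta g := k g *: gamma g b.
have gT g : gamma g (star T * T) =
    1 - beta g * x - star x * (star (beta g) - star (beta g) * beta g * x).
  have -> : gamma g (star T * T) = star (1 - beta g * x) * (1 - beta g * x).
    rewrite rmorphM/= act_star Tb rmorphB rmorph1 rmorphM/= kx.
    by rewrite -scalerAr scalerAl.
  rewrite starB star1 starM mulrBl mul1r; congr (_ - _).
  by rewrite !mulrBr mulr1 !mulrA.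
(* The sum of the beta_g lies in B_{-k}, so its adjoint lies in A x and the sum itself in x^* A. *)
have [a ba] : exists a, (\sum_g beta g) * x = star x * a.
  have kb : Bk k (star (\sum_g beta g)).
    apply: spectral_star; have := spectral_average (dual_conj k) b.
    by under eq_bigr do rewrite /= conjcK.
  move: kb; rewrite gen => -[a _ ax]; exists (star a * x).
  by rewrite -[\sum__ _]starK -ax starM mulrA.
pose Y := a + \sum_g (star (beta g) - star (beta g) * beta g * x).
have SE : \sum_g gamma g (star T * T) = #|G|%:R%:C%:A - star x * Y.
  under eq_bigr do rewrite gT.
  rewrite !sumrB sumr_const -mulr_suml ba -mulr_sumr mulrDr opprD addrA.
  by rewrite rmorph_nat scaler_nat.
(* The average has norm below 1 <= |G|, so |G| minus it, which is x^* Y, is invertible. *)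
have [|r [r1 _ _]] := @neumann _ _ (\sum_g gamma g (star T * T)) #|G|%:R.
  by apply: (lt_le_trans TN); rewrite ler1n (cardD1 1%g) inE.
move: r1; rewrite SE opprB addrC subrK => r1.
exists (star r * star Y).
by rewrite -[X in _ * X = _]starK -!starM mulrA r1 star1.
Qed.

Lemma left_generator_star k x : right_generator A (Bk k) x ->
  left_generator A (Bk (dual_conj k)) (star x).
Proof.
move=> gen; apply/seteqP; split.
- move=> y /spectral_star; rewrite gen => -[a fa ay]; exists (star a).
    exact: star_fixed.
  by rewrite -starM ay starK.
- move=> _ [a fa <-]; rewrite -[a]starK -starM; apply: star_spectral.
  by rewrite gen; exists (star a) => //; exact: star_fixed.
Qed.

(** Left invertibility is applied to x in B_k and to x^* in B_{-k}; the latter is right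
    invertibility of x. *)
Lemma free_generator_invertible k x : free_action gamma -> Bk k x ->
  right_generator A (Bk k) x -> left_generator A (Bk k) x -> invertible x.
Proof.
move=> free kx rx lx.
have [l hl] := free_left_generator_left_invertible free kx lx.
have [r hr] := free_left_generator_left_invertible free (star_spectral kx)
  (left_generator_star rx).
apply: (left_right_invertible (r := star r) hl).
by rewrite -[x]starK -starM hr star1.
Qed.

End Freeness.

(** * The five conditions, linked by a cycle of implications *)

Theorem theorem5p8 (R : realType) (G : finGroupType) (B : cstarAlgType R)
    (gamma : cstar_action G B)
    (G_abelian : abelian [set: G]%SET)
    (B_separable : norm_separable B) :
  let A := fixed_algebra gamma in
  let Bk := spectral_subspace gamma in
  [<-> (forall k : pontryagin_dual R G, exists2 u, Bk k u & unitary u);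
       (forall k : pontryagin_dual R G, exists2 u, Bk k u & invertible u);
       (forall k : pontryagin_dual R G, right_free_rank1 A (Bk k));
       (forall k : pontryagin_dual R G, left_free_rank1 A (Bk k));
       ((forall k : pontryagin_dual R G, exists2 x, Bk k x &
           right_generator A (Bk k) x /\ left_generator A (Bk k) x) /\
        free_action gamma)].
Proof.
move=> A Bk; tfae.
- move=> h k; have [u ku [uu uu']] := h k.
  by exists u => //; exists (star u).
- move=> h k; have [u ku iu] := h k.
  exact: invertible_right_free_rank1 ku iu.
- by move=> h k; exact: right_left_free_rank1.
- move=> h.
  (* Left freeness of B_{-k} becomes right freeness of B_k by taking adjoints, which brings the
     argument back to bases. *)
  have inv : forall k, exists2 u, Bk k u & invertible u.
    apply: right_basis_invertible => k; apply: right_free_rank1_basis.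
    exact: left_right_free_rank1.
  split; last exact: invertible_free.
  move=> k; have [u ku iu] := inv k; exists u => //.
  exact: invertible_generators.
- move=> [h free] k; have [x kx [rx lx]] := h k.
  apply: (invertible_unitary kx).
  exact: free_generator_invertible free kx rx lx.
Qed.
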